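(* Let $X$ be a locally compact non-compact metrizable space. Then the partially ordered sets $\mathcal{E}_K(X)$ and $\mathcal{E}(X)$ are never order-isomorphic.
   Context: For a non-compact metrizable space $X$, $\mathcal{E}(X)$ denotes the set of all one-point metrizable extensions of $X$, i.e. metrizable spaces $Y=X\cup\{p\}$ with $p\notin X$ containing $X$ as a dense subspace, where two such extensions are identified if there is a homeomorphism between them fixing $X$ pointwise. $\mathcal{E}(X)$ is partially ordered by: $Y_1\leq Y_2$ if there is a continuous function from $Y_2$ into $Y_1$ fixing $X$ pointwise. For $X$ locally compact, $\mathcal{E}_K(X)$ is the set of those elements of $\mathcal{E}(X)$ that are locally compact, with the induced order. An order-isomorphism is a bijection that preserves order in both directions. *)

(* Defs.v *)
From HB Require Import structures.
From mathcomp Require Import all_boot all_order all_algebra.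
From mathcomp Require Import all_classical all_reals.
From mathcomp Require Import topology.

Set Implicit Arguments.
Unset Strict Implicit.
Unset Printing Implicit Defensive.

Local Open Scope classical_set_scope.

Definition homeomorphism (S T : topologicalType) (f : S -> T) : Prop :=
  exists g : T -> S,
    [/\ cancel f g, cancel g f, continuous f & continuous g].

Definition metrizable (R : realType) (T : topologicalType) : Prop :=
  exists (M : metricType R) (f : M -> T), homeomorphism f.

(* A one-point metrizable extension Y = X `|` {p} of X.  The carrier is       *)
(* arbitrary and X sits in it through the topological embedding ext_incl.     *)
Record one_point_ext (R : realType) (X : topologicalType) := OnePointExt {
  ext_space :> topologicalType ;
  ext_incl : X -> ext_space ;
  ext_point : ext_space ;
  ext_incl_inj : injective ext_incl ;
  ext_openE : forall A : set X,
    open A <-> exists2 B : set ext_space, open B & ext_incl @^-1` B = A ;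
  ext_point_notin : ~ range ext_incl ext_point ;
  ext_cover : range ext_incl `|` [set ext_point] = [set: ext_space] ;
  ext_dense : dense (range ext_incl) ;
  ext_metrizable : metrizable R ext_space
}.
Arguments ext_incl {R X} _ _.

Section extensions.
Context (R : realType) (X : topologicalType).
Implicit Types Y : one_point_ext R X.

Definition fixes_base Y1 Y2 (f : Y1 -> Y2) : Prop :=
  forall x : X, f (ext_incl Y1 x) = ext_incl Y2 x.

Definition ext_equiv Y1 Y2 : Prop :=
  exists2 f : Y1 -> Y2, homeomorphism f & fixes_base f.

Definition ext_le Y1 Y2 : Prop :=
  exists2 f : Y2 -> Y1, continuous f & fixes_base f.

(* Equivalent extensions are identified, so an element of E(X) is an          *)
(* ext_equiv-class.  Classes are plain predicates: the universe of            *)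
(* classical_sets.set is too small for a type containing topologicalType.     *)
Definition ext_E : Type :=
  {C : one_point_ext R X -> Prop | exists Y, C = ext_equiv Y}.

(* ext_le is invariant under ext_equiv, so the choice of representatives is   *)
(* immaterial.                                                                *)
Definition ext_E_le (C1 C2 : ext_E) : Prop :=
  exists Y1 Y2, [/\ sval C1 Y1, sval C2 Y2 & ext_le Y1 Y2].

Definition ext_EK : Type :=
  {C : ext_E | exists2 Y, sval C Y & locally_compact [set: Y]}.

Definition ext_EK_le (C1 C2 : ext_EK) : Prop := ext_E_le (sval C1) (sval C2).

End extensions.
Arguments ext_E : clear implicits.
Arguments ext_EK : clear implicits.

Definition order_isomorphic (S T : Type) (leS : S -> S -> Prop)
    (leT : T -> T -> Prop) : Prop :=
  exists2 f : S -> T, bijective f &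
    forall x y, leS x y <-> leT (f x) (f y).

(* Main.v *)
Require Import Defs.
From HB Require Import structures.
From mathcomp Require Import all_boot all_order all_algebra.
From mathcomp Require Import all_classical all_reals.
From mathcomp Require Import topology normedtype derive.
From mathcomp Require Import lra.

Set Implicit Arguments.
Unset Strict Implicit.
Unset Printing Implicit Defensive.

Import Order.TTheory GRing.Theory Num.Theory.
Import numFieldNormedType.Exports.

Local Open Scope classical_set_scope.
Local Open Scope ring_scope.

(** The two posets are told apart by a complementation property.  Say that an
    order is relatively complemented when every strict inequality a < b has
    some c >= a that shares no upper bound with b, and such that every d >= a
    shares an upper bound with b or with c.  An order-isomorphism transports
    this property; locally compact one-point extensions have it
    ([EK_relatively_complemented]), arbitrary ones do not
    ([E_not_relatively_complemented]).  (In terms of the Stone-Cech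
    remainder X* of a sigma-compact X: locally compact extensions correspond,
    with the order reversed, to nonempty clopen subsets of X*, arbitrary ones
    to nonempty zero-sets of X*; the difference of two clopen sets is clopen,
    but a zero-set need not be open in a larger one.)

    Everything is computed with gauges: continuous positive functions f on X
    with infimum 0.  The distance to the added point is a gauge, and
    conversely every gauge f is the distance to p in an extension Y_f, where
    the neighbourhoods of p are given by the sets {f < e}
    ([gauge_of_exists], [gauge_ext]).  Then Y_f <= Y_g means that f tends to 0
    wherever g does ([ext_leP]); Y_f and Y_g have a common upper bound iff
    max(f, g) has infimum 0; and, X being locally compact, Y_f is locally
    compact iff, for some e, all the bands {e' <= f <= e} with e' > 0 are
    compact ([gauge_lcP]).

    If Y_f <= Y_g, both have compact bands and e is small, then g stays away
    from the value e where f is small, so the region where f is small splits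
    into a part where g < e and a part where g > e.  The second one is
    described by the gauge max(f, e - g), which is the complement
    ([gauge_lc_complement]).  Without compact bands g can cluster, while f
    tends to 0, at positive values c_n tending to 0.  A complement k of g
    would be bounded below where g < e, for some e; then the gauge
    max(f, |g - c_n|) with c_n < e has an upper bound in common neither with g
    nor with k ([gauge_uncomplemented]).

    Finally, the argument for E(X) has to start somewhere: a noncompact
    metrizable space has a gauge ([noncompact_gauge]). *)

(** * Distances compatible with a topology *)

(** A distance on the points of [T] itself, which spares the transport along
    the homeomorphism hidden in [metrizable]. *)
Record compatible_dist (R : realType) (T : topologicalType) (d : T -> T -> R)
  : Prop := CompatibleDist {
  cdistxx : forall x, d x x = 0 ;
  cdist_eq : forall x y, d x y = 0 -> x = y ;
  cdistC : forall x y, d x y = d y x ;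
  cdist_triangle : forall x y z, d x z <= d x y + d y z ;
  nbhs_cdist : forall x (A : set T),
    nbhs x A <-> exists2 e, 0 < e & forall y, d x y < e -> A y
}.

Section distances.
Context {R : realType}.

Lemma nbhs_mdist (M : metricType R) (x : M) (A : set M) :
  nbhs x A <-> exists2 e : R, 0 < e & forall y, mdist x y < e -> A y.
Proof.
by rewrite nbhs_ballP; split=> -[e e0 eA]; exists e => // y;
  move: (eA y); rewrite ballEmdist.
Qed.

Lemma metrizable_dist (T : topologicalType) :
  metrizable R T -> exists d : T -> T -> R, compatible_dist d.
Proof.
case=> M [f [g [fK gK fc gc]]]; exists (fun x y => mdist (g x) (g y)); split.
- by move=> x; rewrite mdistxx.
- by move=> x y /mdist_positivity /(can_inj gK).
- by move=> x y; exact: metric_sym.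
- by move=> x y z; exact: metric_triangle.
move=> x A; split=> [xA|[e e0 eA]].
  have /nbhs_mdist[e e0 eA] : nbhs (g x) (f @^-1` A).
    by apply: fc; rewrite gK.
  by exists e => // y /eA /=; rewrite gK.
have xe : nbhs (g x) [set z | mdist (g x) z < e] by apply/nbhs_mdist; exists e.
by apply: (@filterS _ (nbhs x) _ _ _ _ (gc _ _ xe)) => y; exact: eA.
Qed.

Lemma metrizable_hausdorff (T : topologicalType) :
  metrizable R T -> hausdorff_space T.
Proof.
case=> M [f [g [fK gK fc gc]]] x y xy.
rewrite -(gK x) -(gK y); congr f; apply: metric_hausdorff => A B gxA gyB.
have [z [Az Bz]] := xy _ _ (gc _ _ gxA) (gc _ _ gyB).
by exists (g z).
Qed.

Section metric_of_dist.
Context {T : choiceType} {D : T -> T -> R}.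
Hypothesis D0 : forall x, D x x = 0.
Hypothesis Deq : forall x y, D x y = 0 -> x = y.
Hypothesis DC : forall x y, D x y = D y x.
Hypothesis Dtri : forall y x z, D x z <= D x y + D y z.

(** A name of its own for the carrier keeps the metric structure declared on
    it from being inferred on arbitrary types. *)
Definition dist_carrier : Type := T.
HB.instance Definition _ := Choice.copy dist_carrier T.
HB.instance Definition _ := @isMetric.Build R dist_carrier D D0 Deq DC Dtri.

Lemma metricType_of_dist :
  exists (M : metricType R) (g : T -> M) (g' : M -> T),
    [/\ cancel g g', cancel g' g & forall x y, mdist (g x) (g y) = D x y].
Proof. by exists dist_carrier, id, id; split. Qed.

End metric_of_dist.

Section compatible.
Context {T : topologicalType} {d : T -> T -> R}.
Hypothesis hd : compatible_dist d.

Lemma cdist_ge0 x y : 0 <= d x y.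
Proof.
have := cdist_triangle hd x y x; rewrite (cdistxx hd) (cdistC hd y x); lra.
Qed.

Lemma cdist_gt0 x y : x <> y -> 0 < d x y.
Proof.
move=> xy; rewrite lt_neqAle cdist_ge0 andbT; apply/eqP => /esym.
by move/(cdist_eq hd).
Qed.

Lemma nbhs_cball x e : 0 < e -> nbhs x [set y | d x y < e].
Proof. by move=> e0; apply/(nbhs_cdist hd); exists e. Qed.

Lemma lipschitz_continuous (f : T -> R) :
  (forall x y, f x <= f y + d x y) -> continuous f.
Proof.
move=> fd x; apply/cvgrPdist_lt => e e0.
apply: filterS (nbhs_cball x e0) => y /= xy.
have := fd x y; have := fd y x; rewrite (cdistC hd y x) ltr_norml; lra.
Qed.

End compatible.

Lemma dominated_continuous (T : topologicalType) (f h : T -> R) :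
  continuous h -> (forall x y, `|f x - f y| <= `|h x - h y|) -> continuous f.
Proof.
move=> hc fh x; apply/cvgrPdist_lt => e e0.
have /cvgrPdist_lt/(_ e e0) := hc x.
by apply: filterS => y; exact: le_lt_trans.
Qed.

(** The common source of Lipschitz functions below: an infimum moves by at
    most [e] when every competitor does. *)
Lemma inf_shift (A B : set R) (e : R) :
  A !=set0 -> B !=set0 -> lbound A 0 ->
  (forall b, B b -> exists2 a, A a & a <= b + e) -> inf A <= inf B + e.
Proof.
move=> A0 B0 lA BA; rewrite -lerBlDr; apply: lb_le_inf => // b /BA[a Aa ab].
rewrite lerBlDr; apply: le_trans ab; apply: ge_inf => //; by exists 0.
Qed.

End distances.

(** * Gauges *)

Section gauges.
Context {R : realType} {X : topologicalType}.
Implicit Types f g h : X -> R.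

(** A gauge plays the part of the distance to a point at infinity. *)
Definition gauge f :=
  [/\ continuous f, (forall x, 0 < f x) & forall e, 0 < e -> exists x, f x < e].

(** The order on extensions read on gauges, see [ext_leP]. *)
Definition gauge_le f g :=
  forall e, 0 < e -> exists2 e', 0 < e' & forall x, g x < e' -> f x < e.

(** Local compactness of the extension at its added point, see [gauge_lcP]. *)
Definition gauge_lc f :=
  exists2 e, 0 < e &
    forall e', 0 < e' -> compact [set x | e' <= f x <= e].

Lemma gauge_le_maxl f g : gauge_le f (f \max g).
Proof. by move=> e e0; exists e => // x; rewrite gt_max => /andP[]. Qed.

Lemma gauge_le_maxr f g : gauge_le g (f \max g).
Proof. by move=> e e0; exists e => // x; rewrite gt_max => /andP[]. Qed.

(** When [g] is a gauge too, the maximum represents the least common upper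
    bound; it exists as soon as [f] and [g] are small simultaneously. *)
Lemma gauge_max f g : gauge f -> continuous g ->
  (forall e, 0 < e -> exists2 x, f x < e & g x < e) -> gauge (f \max g).
Proof.
move=> [fc f0 _] gc fg; split.
- exact: max_fun_continuous.
- by move=> x; rewrite lt_max f0.
- by move=> e /fg[x fx gx]; exists x; rewrite gt_max fx.
Qed.

Lemma closed_band f a b : continuous f -> closed [set x | a <= f x <= b].
Proof.
move=> fc; have -> : [set x | a <= f x <= b] =
    f @^-1` [set t | a <= t] `&` f @^-1` [set t | t <= b].
  by apply/seteqP; split=> x /= => [/andP[]|[-> ->]].
apply: closedI; apply: preimage_closed; try by move=> x _; exact: fc.
- exact: closed_ge.
- exact: closed_le.
Qed.

Lemma compact_pos_lbound f (K : set X) : gauge f -> compact K ->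
  exists2 m, 0 < m & forall x, K x -> m <= f x.
Proof.
move=> [fc f0 _] cK; have [K0|K0] := pselect (K !=set0); last first.
  by exists 1 => // x Kx; case: K0; exists x.
have [c _ cmin] := compact_EVT_min K0 cK (continuous_subspaceT fc).
by exists (f c) => // x /mem_set; exact: cmin.
Qed.

Lemma gauge_lc_max f g : continuous f -> continuous g ->
  gauge_lc f -> gauge_lc g -> gauge_lc (f \max g).
Proof.
move=> fc gc [a a0 fa] [b b0 gb]; exists (Num.min a b).
  by rewrite lt_min a0.
move=> e' e'0; apply: subclosed_compact (compactU (fa _ e'0) (gb _ e'0)) _.
  by apply: closed_band; exact: max_fun_continuous.
move=> x /=; rewrite le_max ge_max !le_min => /andP[/orP[fx|gx]] /andP[/andP[]].
  by move=> fa' _ _; left; rewrite fx.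
by move=> _ _ /andP[_ gb']; right; rewrite gx.
Qed.

(** On a compact band {n <= g <= eg} the gauge [f] is bounded below, so where
    [f] is small [g] is either below [n] or above [eg].  The gauge
    max(f, eg - g) isolates the second alternative.  A gauge [h] above [f]
    that does not meet it ends up in the region g <= eg, where the same
    dichotomy forces [g] to 0. *)
Lemma gauge_lc_complement f g : gauge f -> gauge g -> gauge_lc f ->
  gauge_lc g -> gauge_le f g -> ~ gauge_le g f ->
  exists k, [/\ gauge k, gauge_lc k, gauge_le f k,
    (exists2 e, 0 < e & forall x, ~ (g x < e /\ k x < e)) &
    forall h, gauge h -> gauge_le f h ->
      gauge_le g h \/ forall e, 0 < e -> exists2 x, h x < e & k x < e].
Proof.
move=> gf gg [ef ef0 cf] [eg eg0 cg] fg ngf.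
have [fc f0 _] := gf; have [gc g0 _] := gg.
have kc : continuous (fun x => eg - g x).
  by move=> x; apply: cvgB; [exact: cvg_cst|exact: gc].
pose k := f \max (fun x => eg - g x).
have kE e x : (k x < e) = (f x < e) && (eg - g x < e) by rewrite /k gt_max.
exists k; split.
- apply: gauge_max => // e e0.
  (* the failure of gauge_le g f yields points with f small and g >= n *)
  have [n [n0 nP]] : exists n, 0 < n /\ forall e', 0 < e' ->
      exists2 x, f x < e' & n <= g x.
    apply: contrapT => H; apply: ngf => n n0; apply: contrapT => H'.
    apply: H; exists n; split => // e' e'0; apply: contrapT => H''; apply: H'.
    exists e' => // x fx; rewrite ltNge; apply/negP => gx; apply: H''.
    by exists x.
  have [m m0 mP] := compact_pos_lbound gf (cg _ n0).
  have [x] := nP (Num.min e m) (ltac:(by rewrite lt_min e0)).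
  rewrite lt_min => /andP[fe fm] nx; exists x => //.
  rewrite ltrBlDr; apply: (@lt_trans _ _ (g x)); last by rewrite ltrDr.
  rewrite ltNge; apply/negP => gx; have := mP x (ltac:(by rewrite /= nx)).
  by rewrite leNgt fm.
- exists (Num.min ef (eg / 2)); first by rewrite lt_min ef0 divr_gt0.
  (* a band of k lies in the union of a band of f and a band of g *)
  move=> e' e'0.
  have eg2 : 0 < eg / 2 by rewrite divr_gt0.
  apply: subclosed_compact (compactU (cf _ e'0) (cg _ eg2)) _.
    by apply: closed_band; exact: max_fun_continuous.
  move=> x /=; rewrite /k le_max ge_max !le_min.
  move=> /andP[/orP[fx|gx]] /andP[/andP[fef _] /andP[_ geg]].
    by left; rewrite fx.
  by right; apply/andP; lra.
- exact: gauge_le_maxl.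
- exists (eg / 2); first by rewrite divr_gt0.
  by move=> x [gx]; rewrite kE => /andP[_]; lra.
- move=> h [hc h0 hinf] fh.
  have [H|H] := pselect (forall e, 0 < e -> exists2 x, h x < e & k x < e).
    by right.
  left => e e0; have [n [n0 nP]] : exists n, 0 < n /\
      forall x, h x < n -> n <= k x.
    apply: contrapT => H'; apply: H => n n0; apply: contrapT => H''; apply: H'.
    exists n; split => // x hx; rewrite leNgt; apply/negP => kx; apply: H''.
    by exists x.
  have [m m0 mP] := compact_pos_lbound gf (cg _ e0).
  have [a a0 aP] := fh _ n0; have [b b0 bP] := fh _ m0.
  exists (Num.min n (Num.min a b)); first by rewrite !lt_min n0 a0.
  move=> x; rewrite !lt_min => /and3P[/nP nk /aP fn /bP fm].
  rewrite ltNge; apply/negP => egx; move: fm; rewrite ltNge mP//= egx /=.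
  by move: nk; rewrite leNgt kE fn /= -leNgt; lra.
Qed.

End gauges.

(** * One-point extensions as gauges *)

Section extension_gauge.
Context {R : realType} {X : topologicalType}.
Implicit Types (Y : one_point_ext R X) (f : X -> R).

Definition gauge_of Y f := gauge f /\
  forall A : set Y, nbhs (ext_point Y) A <->
    A (ext_point Y) /\ exists2 e, 0 < e & forall x, f x < e -> A (ext_incl Y x).

Lemma ext_pointP Y (y : Y) : y = ext_point Y \/ exists x, y = ext_incl Y x.
Proof.
have : [set: Y] y by [].
by rewrite -(ext_cover Y) => -[[x _ <-]|->]; [right; exists x|left].
Qed.

Lemma ext_incl_neq Y x : ext_incl Y x <> ext_point Y.
Proof. by move=> xp; apply: (@ext_point_notin _ _ Y); exists x. Qed.

(** [X] is open in [Y], because the added point is closed. *)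
Lemma nbhs_ext_incl Y x (A : set Y) :
  nbhs (ext_incl Y x) A <-> nbhs x (ext_incl Y @^-1` A).
Proof.
split.
  rewrite nbhsE => -[B [oB Bx] BA].
  apply: (@filterS _ (nbhs x) _ (ext_incl Y @^-1` B)) => [z /BA//|].
  by apply: open_nbhs_nbhs; split => //; apply/(ext_openE Y); exists B.
rewrite nbhsE => -[C [/(ext_openE Y)[B oB <-] Bx] BA].
have op : open (~` [set ext_point Y]).
  rewrite openC; apply: accessible_closed_set1; apply: hausdorff_accessible.
  exact: metrizable_hausdorff (ext_metrizable Y).
apply: (@filterS _ (nbhs (ext_incl Y x)) _ (B `&` ~` [set ext_point Y])).
  by move=> y [By yp]; case: (ext_pointP y) By => [//|[z ->]]; exact: BA.
apply: open_nbhs_nbhs; split; first exact: openI.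
by split => //; exact: ext_incl_neq.
Qed.

Lemma continuous_ext_incl Y : continuous (ext_incl Y).
Proof. by move=> x A /nbhs_ext_incl. Qed.

(** The distance to the added point; its infimum is 0 by density of [X]. *)
Lemma gauge_of_exists Y : exists f, gauge_of Y f.
Proof.
have [d hd] := metrizable_dist (ext_metrizable Y).
pose p := ext_point Y; pose f x := d (ext_incl Y x) p.
have nbhsf (A : set Y) : nbhs p A <->
    A p /\ exists2 e, 0 < e & forall x, f x < e -> A (ext_incl Y x).
  split=> [pA|[Ap [e e0 eA]]].
    split; first exact: nbhs_singleton.
    have [e e0 eA] := (nbhs_cdist hd _ _).1 pA.
    by exists e => // x fx; apply: eA; rewrite (cdistC hd).
  apply/(nbhs_cdist hd); exists e => // y; rewrite (cdistC hd).
  by case: (ext_pointP y) => [->//|[x ->]]; exact: eA.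
exists f; split => //; split.
- move=> x; apply/cvgrPdist_lt => e e0; rewrite !near_simpl.
  have /nbhs_ext_incl := nbhs_cball hd (ext_incl Y x) e0.
  apply: filterS => y /= xy; rewrite ltr_norml /f.
  have := cdist_triangle hd (ext_incl Y x) (ext_incl Y y) p.
  have := cdist_triangle hd (ext_incl Y y) (ext_incl Y x) p.
  by rewrite (cdistC hd (ext_incl Y y) (ext_incl Y x)); lra.
- by move=> x; apply: (cdist_gt0 hd); exact: ext_incl_neq.
- move=> e e0; have pe := nbhs_cball hd p e0.
  have : (interior [set y | d p y < e]) !=set0 by exists p.
  move/(@ext_dense _ _ Y) => /(_ (open_interior _))[z [/interior_subset pz [x _ xz]]].
  by exists x; rewrite /f (cdistC hd) xz.
Qed.

(** A map over [X] must send the added point to the added point: otherwise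
    points of [X] tending to infinity in [Y2] would converge in [X], where
    [f2] is bounded below.  After that, both sides say that the map is
    continuous at the added point. *)
Lemma ext_leP Y1 Y2 f1 f2 : gauge_of Y1 f1 -> gauge_of Y2 f2 ->
  ext_le Y1 Y2 <-> gauge_le f1 f2.
Proof.
move=> [[f1c f10 f1inf] n1] [[f2c f20 f2inf] n2]; split.
- move=> [phi phic phiE].
  have phip : phi (ext_point Y2) = ext_point Y1.
    case: (ext_pointP (phi (ext_point Y2))) => // -[x phip].
    (* f2 > f2 x / 2 near x, whereas points near the added point of Y2, on
       which f2 is arbitrarily small, are sent near x *)
    have : nbhs (ext_incl Y1 x) (ext_incl Y1 @` [set z | f2 x / 2 < f2 z]).
      apply/nbhs_ext_incl; have x2 : f2 x / 2 < f2 x by have := f20 x; lra.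
      have : nbhs x [set z | f2 x / 2 < f2 z].
        apply: open_nbhs_nbhs; split => //.
        by apply: (@open_comp _ _ f2 [set t | f2 x / 2 < t]) => [z _|];
          [exact: f2c|exact: open_gt].
      by apply: filterS => z zx; exists z.
    rewrite -phip => /phic/n2[_ [e e0 eP]].
    have [z] := f2inf (Num.min e (f2 x / 2))
      (ltac:(by rewrite lt_min e0 divr_gt0)).
    rewrite lt_min => /andP[/eP /= [t tx]]; rewrite phiE.
    by move/ext_incl_inj => <- /(lt_trans tx); rewrite ltxx.
  move=> e e0.
  have : nbhs (phi (ext_point Y2))
      [set y | forall x, y = ext_incl Y1 x -> f1 x < e].
    rewrite phip; apply/n1; split; first by move=> x /esym/ext_incl_neq.
    by exists e => // x fx z /ext_incl_inj <-.
  move/phic/n2 => [_ [e' e'0 e'P]]; exists e' => // x /e'P /=.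
  by apply; exact: phiE.
- move=> f12.
  have /boolp.choice[phi phiP] : forall y : Y2, exists z : Y1,
      (y = ext_point Y2 /\ z = ext_point Y1) \/
      exists2 x, y = ext_incl Y2 x & z = ext_incl Y1 x.
    move=> y; case: (ext_pointP y) => [->|[x ->]].
      by exists (ext_point Y1); left.
    by exists (ext_incl Y1 x); right; exists x.
  have phiE x : phi (ext_incl Y2 x) = ext_incl Y1 x.
    by case: (phiP (ext_incl Y2 x)) => [[/ext_incl_neq]//|[z /ext_incl_inj->]].
  have phip : phi (ext_point Y2) = ext_point Y1.
    by case: (phiP (ext_point Y2)) => [[]//|[z /esym/ext_incl_neq]].
  exists phi => // y; case: (ext_pointP y) => [->|[x ->]] A.
    rewrite phip => /n1[Ap [e e0 eA]].
    have [e' e'0 e'P] := f12 _ e0.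
    apply/n2; split; first by rewrite /= phip.
    by exists e' => // x /e'P/eA; rewrite /= phiE.
  rewrite phiE => /nbhs_ext_incl H; apply/nbhs_ext_incl.
  by apply: (@filterS _ (nbhs x) _ _ _ _ H) => z; rewrite /= phiE.
Qed.

(** For a compatible distance d, the distance
    d x y + |f x - f y| is compatible too and makes [f] 1-Lipschitz.  Passing
    through [p], at distance [f x] from [x], is then allowed as a shortcut of
    length f x + f y without breaking the triangle inequality, and does not
    alter small balls around points of [X]. *)
Lemma gauge_ext f : metrizable R X -> gauge f ->
  exists Y : one_point_ext R X, gauge_of Y f.
Proof.
move=> /metrizable_dist[d hd] fg; have [fc f0 finf] := fg.
pose D (u v : option X) : R := match u, v with
  | Some x, Some y => Num.min (d x y + `|f x - f y|) (f x + f y)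
  | Some x, None => f x | None, Some y => f y | None, None => 0 end.
have D0 u : D u u = 0.
  case: u => //= x; rewrite (cdistxx hd) subrr normr0 addr0.
  by apply/min_idPl; have := f0 x; lra.
have Deq u v : D u v = 0 -> u = v.
  case: u v => [x|] [y|] //= H; last 2 first.
  - by have := f0 x; rewrite H ltxx.
  - by have := f0 y; rewrite H ltxx.
  congr Some; apply: (cdist_eq hd); have := f0 x; have := f0 y.
  have := cdist_ge0 hd x y; have := normr_ge0 (f x - f y).
  move: H; case: (leP (d x y + _)) => _ H *; first by apply/eqP; rewrite eq_le; lra.
  by exfalso; lra.
have DC u v : D u v = D v u.
  case: u v => [x|] [y|] //=.
  by rewrite (cdistC hd) distrC [f x + _]addrC.
have Dtri v u w : D u w <= D u v + D v w.
  case: u v w => [x|] [y|] [z|] //=.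
  - have := cdist_triangle hd x y z; have := f0 x; have := f0 y; have := f0 z.
    have := ler_distD (f y) (f x) (f z).
    have : `|f x - f y| >= f x - f y := ler_norm _.
    have : `|f y - f z| >= f z - f y by rewrite distrC ler_norm.
    have := cdist_ge0 hd x y; have := cdist_ge0 hd y z.
    by rewrite ge_min; case: (leP (d x y + _)); case: (leP (d y z + _));
      move=> *; apply/orP; (left; lra) || (right; lra).
  - have := f0 x; have := f0 y; have : `|f x - f y| >= f x - f y := ler_norm _.
    by have := cdist_ge0 hd x y; case: (leP (d x y + _)); lra.
  - have := f0 x; have := f0 z; by case: (leP (d x z + _)); lra.
  - have := f0 x; by lra.
  - have := f0 z; have := f0 y.
    have : `|f y - f z| >= f z - f y by rewrite distrC ler_norm.
    by have := cdist_ge0 hd y z; case: (leP (d y z + _)); lra.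
  - by have := f0 y; lra.
  - by rewrite add0r.
  - by rewrite addr0.
have [M [g [g' [gK g'K gD]]]] := metricType_of_dist D0 Deq DC Dtri.
pose i x := g (Some x); pose p := g None.
have iinj : injective i by move=> x y /(can_inj gK) [].
have pointP m : m = p \/ exists x, m = i x.
  by rewrite -(g'K m); case: (g' m) => [x|]; [right; exists x|left].
have nbhsp (A : set M) : nbhs p A <->
    A p /\ exists2 e, 0 < e & forall x, f x < e -> A (i x).
  split=> [pA|[Ap [e e0 eA]]].
    split; first exact: nbhs_singleton.
    have [e e0 eA] := (nbhs_mdist _ _).1 pA.
    by exists e => // x fx; apply: eA; rewrite gD.
  apply/nbhs_mdist; exists e => // m.
  by case: (pointP m) => [->//|[x ->]]; rewrite gD; exact: eA.
have nbhsi x (A : set M) : nbhs (i x) A <-> nbhs x (i @^-1` A).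
  split=> [/nbhs_mdist[e e0 eA]|xA]; last first.
    have [e e0 eA] := (nbhs_cdist hd _ _).1 xA.
    apply/nbhs_mdist; exists (Num.min e (f x)); first by rewrite lt_min e0 f0.
    move=> m; case: (pointP m) => [->|[y ->]]; rewrite gD /= lt_min.
      by rewrite ltxx andbF.
    rewrite !gt_min => /andP[H1 H2]; apply: eA; move: H1 H2.
    have := normr_ge0 (f x - f y); have := f0 y.
    by move=> H1 H2 /orP[] H3 /orP[] H4; lra.
  have e20 : 0 < e / 2 by rewrite divr_gt0.
  have /cvgrPdist_lt/(_ _ e20) := fc x.
  have := nbhs_cball hd x e20; apply: filterS2 => y /= dxy fxy.
  by apply: eA; rewrite gD /= gt_min; apply/orP; left; lra.
have openP (A : set X) : open A <-> exists2 B : set M, open B & i @^-1` B = A.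
  split=> [oA|[B oB <-]].
    exists (i @` A); last first.
      by apply/seteqP; split=> x /= => [[y Ay /iinj <-]//|Ax]; exists x.
    rewrite openE => _ [x Ax <-]; apply/nbhsi.
    move: oA; rewrite openE => /(_ _ Ax); apply: filterS => y Ay.
    by exists y.
  rewrite openE => x Bx; apply/nbhsi; apply: open_nbhs_nbhs; by split.
have ip x : i x <> p by move/(can_inj gK).
have pni : ~ range i p by move=> [x _ /ip].
have cover : range i `|` [set p] = [set: M].
  apply/seteqP; split=> // m _.
  by case: (pointP m) => [->|[x ->]]; [right|left; exists x].
have idense : dense (range i).
  move=> O [m Om] oO; case: (pointP m) => [mp|[x mx]]; last first.
    by exists m; split=> //; exists x.
  have /nbhsp[_ [e e0 eO]] : nbhs p O.
    by apply: open_nbhs_nbhs; split=> //; rewrite -mp.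
  have [x fx] := finf _ e0.
  by exists (i x); split; [exact: eO|exists x].
have Mm : metrizable R M by exists M, id, id; split=> // x; exact: cvg_id.
by exists (OnePointExt iinj openP pni cover idense Mm); split.
Qed.

End extension_gauge.

(** * Local compactness of an extension *)

Section local_compactness.
Context {R : realType} {X : topologicalType}.
Implicit Types (Y : one_point_ext R X) (f : X -> R).

Lemma compact_ext_incl Y (K : set X) :
  compact (ext_incl Y @` K) <-> compact K.
Proof.
split=> [cK F FF FK|]; last first.
  by apply: continuous_compact; apply: continuous_subspaceT;
    exact: continuous_ext_incl.
have [|_ [[x Kx <-] xF]] := cK (ext_incl Y @ F) _.
  by apply: (@filterS _ F _ K) => // x Kx; exists x.
exists x; split=> // A B FA xB.
have iA : (ext_incl Y @ F) (ext_incl Y @` A).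
  by apply: (@filterS _ F _ A) => // z Az; exists z.
have iB : nbhs (ext_incl Y x) (ext_incl Y @` B).
  by apply/nbhs_ext_incl; apply: (@filterS _ (nbhs x) _ B) => // z Bz; exists z.
have [_ [[y Ay <-] [z Bz /ext_incl_inj yz]]] := xF _ _ iA iB.
by exists y; split=> //; rewrite -yz.
Qed.

(** A band of [f] is closed in [Y] because it avoids a neighbourhood of the
    added point.  Conversely the set {f <= e} with [p] added is compact: an
    ultrafilter on it that does not converge to [p] lives on a band. *)
Lemma gauge_lcP Y f : gauge_of Y f -> locally_compact [set: X] ->
  locally_compact [set: Y] <-> gauge_lc f.
Proof.
move=> [[fc f0 finf] nbhsp] Xlc; split.
- move=> /(_ (ext_point Y) I)[U]; rewrite withinET => /nbhsp[Up [e e0 eU]] [cU _].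
  exists (e / 2); first by rewrite divr_gt0.
  move=> e' e'0; apply/(compact_ext_incl Y).
  apply: subclosed_compact cU _; last first.
    by move=> _ [x /= /andP[_ fx] <-]; apply: eU; lra.
  rewrite -openC openE => y yK; case: (ext_pointP y) yK => [->|[x ->]] yK.
    apply/nbhsp; split; first by move=> [x _ /ext_incl_neq].
    exists e' => // x fx [z /= /andP[fz _] /ext_incl_inj zx].
    by move: fz; rewrite zx leNgt fx.
  apply/nbhs_ext_incl; apply: open_nbhs_nbhs; split=> //=.
  have -> : ext_incl Y @^-1` (~` (ext_incl Y @` [set x | e' <= f x <= e / 2]))
      = ~` [set x | e' <= f x <= e / 2].
    apply/seteqP; split=> z /= zK; first by move=> zf; apply: zK; exists z.
    by move=> [t tf /ext_incl_inj tz]; apply: zK; rewrite -tz.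
  by rewrite openC; exact: closed_band.
- move=> [e e0 cf] y _; have hY := metrizable_hausdorff (ext_metrizable Y).
  suff [U yU cU] : exists2 U, nbhs y U & compact U.
    by exists U; [rewrite withinET|split=> //; exact: compact_closed].
  case: (ext_pointP y) => [->|[x ->]]; last first.
    have [U] := Xlc x I; rewrite withinET => xU [cU _].
    exists (ext_incl Y @` U); last exact/compact_ext_incl.
    apply/nbhs_ext_incl; apply: (@filterS _ (nbhs x) _ U) => // z Uz.
    by exists z.
  pose p := ext_point Y.
  exists [set y | forall x, y = ext_incl Y x -> f x <= e].
    apply/nbhsp; split; first by move=> x /esym/ext_incl_neq.
    by exists e => // x fx z /ext_incl_inj <-; exact: ltW.
  rewrite compact_ultra => F FU FK.
  have [Fp|nFp] := pselect (F --> p).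
    by exists p; split=> //= x /esym/ext_incl_neq.
  have [A pA nFA] : exists2 A, nbhs p A & ~ F A.
    apply: contrapT => H; apply: nFp => A pA; apply: contrapT => FA.
    by apply: H; exists A.
  have /nbhsp[Ap [e' e'0 e'A]] := pA.
  have FCA : F (~` A) by have [] := in_ultra_setVsetC A FU.
  have : compact (ext_incl Y @` [set x | e' <= f x <= e]).
    exact/compact_ext_incl/cf.
  rewrite compact_ultra => /(_ F FU)[|_ [[x /andP[_ fx] <-] Fx]].
    apply: filterS2 FK FCA => z zK zA; case: (ext_pointP z) => [zp|[x zx]].
      by case: zA; rewrite zp.
    exists x => //=; rewrite (zK _ zx) andbT leNgt; apply/negP => fx.
    by apply: zA; rewrite zx; exact: e'A.
  by exists (ext_incl Y x); split=> // z /ext_incl_inj <-.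
Qed.

End local_compactness.

(** * Noncompact metrizable spaces have gauges *)

Lemma greedy_sequence (T : choiceType) (Q : T -> T -> Prop) :
  (forall s : seq T, exists y, forall x, x \in s -> Q x y) ->
  exists u : nat -> T, forall i j, (i < j)%N -> Q (u i) (u j).
Proof.
move=> /boolp.choice[pick pickP].
pose L := fix L n := if n is m.+1 then pick (L m) :: L m else [::].
exists (fun n => pick (L n)) => i j ij; apply: pickP.
elim: j ij => // j IH; rewrite ltnS leq_eqVlt => /orP[/eqP->|/IH ij] /=.
  by rewrite inE eqxx.
by rewrite inE ij orbT.
Qed.

Section gauge_existence.
Context {R : realType} {X : topologicalType} {d : X -> X -> R}.
Hypothesis hd : compatible_dist d.

(** The gauge is the infimum over k of d x (u k) + 1/(k+1).  A ball of radius
    r/2 contains at most one term of the sequence, whence positivity. *)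
Lemma gauge_of_separated (r : R) (u : nat -> X) : 0 < r ->
  (forall i j, (i < j)%N -> r <= d (u i) (u j)) -> exists f : X -> R, gauge f.
Proof.
move=> r0 ur.
pose w (k : nat) : R := k.+1%:R^-1.
have w0 k : 0 < w k by rewrite invr_gt0.
pose S x := range (fun k => d x (u k) + w k).
have S0 x : S x !=set0 by exists (d x (u 0%N) + w 0%N), 0%N.
have lS x : lbound (S x) 0.
  by move=> _ [k _ <-]; rewrite addr_ge0 ?(cdist_ge0 hd)// ltW.
exists (fun x => inf (S x)); split.
- apply: (lipschitz_continuous hd) => x y; apply: inf_shift => //.
  move=> _ [k _ <-]; exists (d x (u k) + w k); first by exists k.
  have := cdist_triangle hd x y (u k); lra.
- move=> x.
  have [[k xk]|H] := pselect (exists k, d x (u k) < r / 2); last first.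
    have r2 : 0 < r / 2 by rewrite divr_gt0.
    apply: lt_le_trans r2 _; apply: lb_le_inf => // _ [k _ <-].
    have := w0 k; have : r / 2 <= d x (u k).
      by rewrite leNgt; apply/negP => ?; apply: H; exists k.
    lra.
  have m0 : 0 < Num.min (r / 2) (w k) by rewrite lt_min w0 divr_gt0.
  apply: lt_le_trans m0 _; apply: lb_le_inf => // _ [j _ <-].
  rewrite ge_min; apply/orP; have [->|jk] := eqVneq j k.
    by right; have := cdist_ge0 hd x (u k); lra.
  left; have rjk : r <= d (u j) (u k).
    move: jk; rewrite neq_ltn => /orP[/ur//|/ur].
    by rewrite (cdistC hd).
  have := cdist_triangle hd (u j) x (u k); rewrite (cdistC hd (u j) x).
  have := w0 j; lra.
- move=> e e0; pose k := Num.truncn e^-1.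
  exists (u k); apply: (@le_lt_trans _ _ (w k)).
    by apply: ge_inf; [exists 0; exact: lS|exists k; rewrite ?(cdistxx hd) ?add0r].
  rewrite /w invf_plt ?posrE//.
  by rewrite truncnS_gt.
Qed.

(** Let [F] be a filter without cluster point.  The lower limit along [F] of
    the distance to x, truncated at 1, is 1-Lipschitz in x, and positive since
    x is not a cluster point.  If its infimum is not 0, then all balls
    of some fixed radius miss a set of [F], hence so do finite unions of them,
    and [X] contains an infinite separated sequence. *)
Lemma noncompact_gauge : ~ compact [set: X] -> exists f : X -> R, gauge f.
Proof.
move=> /existsNP[F /not_implyP[FF /not_implyP[FT /forallNP Fcl]]].
pose meets x (r : R) := forall A, F A -> exists2 a, A a & d x a < r.
pose S x := [set r | 0 <= r /\ (1 <= r \/ meets x r)].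
have S0 x : S x !=set0 by exists 1; split=> //; left.
have lS x : lbound (S x) 0 by move=> r [].
pose f x := inf (S x).
have fc : continuous f.
  apply: (lipschitz_continuous hd) => x y; apply: inf_shift => //.
  move=> r [r0 Sr]; exists (r + d x y) => //.
  have dxy := cdist_ge0 hd x y.
  split; first by rewrite addr_ge0.
  case: Sr => [r1|yr]; first by left; lra.
  right=> A /yr[a Aa ya]; exists a => //.
  by have := cdist_triangle hd x y a; lra.
have f0 x : 0 < f x.
  have : ~ cluster F x by move=> Fx; apply: (Fcl x).
  move=> /existsNP[A /existsNP[B /not_implyP[FA /not_implyP[xB AB]]]].
  have [e e0 eB] := (nbhs_cdist hd _ _).1 xB.
  have m0 : 0 < Num.min 1 e by rewrite lt_min ltr01.
  apply: lt_le_trans m0 _; apply: lb_le_inf => // r [_ [r1|xr]].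
    by rewrite ge_min r1.
  rewrite ge_min; apply/orP; right; rewrite leNgt; apply/negP => re.
  have [a Aa xa] := xr _ FA; apply: AB; exists a; split=> //; apply: eB.
  exact: lt_trans re.
have [finf|] := pselect (forall e, 0 < e -> exists x, f x < e).
  by exists f.
move=> /existsNP[e /not_implyP[e0 /forallNP fe]].
pose r := Num.min 1 e / 2.
have r0 : 0 < r by rewrite divr_gt0// lt_min ltr01.
have nmeets x : exists2 A, F A & forall a, A a -> r <= d x a.
  have : ~ meets x r.
    move=> xr; apply: (fe x); apply: (@le_lt_trans _ _ r).
      by apply: ge_inf; [exists 0; exact: lS|split; [exact: ltW|right]].
    by rewrite /r; case: (leP 1 e); lra.
  move=> /existsNP[A /not_implyP[FA H]]; exists A => // a Aa.
  by rewrite leNgt; apply/negP => xa; apply: H; exists a.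
suff [u ur] : exists u : nat -> X, forall i j, (i < j)%N -> r <= d (u i) (u j).
  exact: gauge_of_separated r0 ur.
apply: (@greedy_sequence X (fun x y => r <= d x y)) => s.
suff [A FA sA] : exists2 A, F A & forall x, x \in s -> forall a, A a -> r <= d x a.
  by have [a Aa] := filter_ex FA; exists a => x /sA; exact.
elim: s => [|x s [A FA sA]]; first by exists setT.
have [B FB xB] := nmeets x; exists (A `&` B); first exact: filterI.
by move=> y; rewrite inE => /orP[/eqP->|/sA yA] a [] => [_ /xB|/yA].
Qed.

End gauge_existence.

(** * A gauge without complement *)

Section uncomplemented.
Context {R : realType} {X : topologicalType}.

(** The weight of k is 1/(v+1), with v the 2-adic valuation of k. *)
Lemma recurrent_weights : exists c : nat -> R,
  [/\ forall k, 0 < c k <= 1, forall e, 0 < e -> exists k, c k < e &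
      forall k m, exists2 n, (m <= n)%N & c n = c k].
Proof.
exists (fun k => (logn 2 k).+1%:R^-1); split.
- by move=> k; rewrite invr_gt0 ltr0n /= invf_le1// ler1n.
- move=> e e0; exists (2 ^ Num.truncn e^-1)%N.
  by rewrite pfactorK// invf_plt ?posrE// truncnS_gt.
- move=> k m; exists (2 ^ logn 2 k * m.*2.+1)%N.
    rewrite -addnn; apply: (@leq_trans (m + m).+1); last exact: leq_pmull.
    by rewrite leqW// leq_addr.
  rewrite lognM ?expn_gt0// pfactorK// [logn 2 _.+1]lognE /=.
  by rewrite dvdn2 /= odd_double addn0.
Qed.

(** With h = 1/f, choose points u k whose values h (u k) are at mutual
    distance at least 1, and let psi be the infimum over k of
    c k + |h - h (u k)|.  As the weights c k lie in ]0, 1], psi takes the value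
    c k at u k.  Each weight recurs infinitely often, so f tends to 0 along
    the column {psi = c n} for every n.  The gauge [g] is max(f, psi), and
    [q] is max(f, |psi - c n|) with c n < e / 2: where it is small, [g] is
    close to c n, hence both away from 0 and less than e. *)
Lemma gauge_uncomplemented (f : X -> R) : gauge f ->
  exists g, [/\ gauge g, gauge_le f g, ~ gauge_le g f &
    forall k e, 0 < e -> (forall x, ~ (g x < e /\ k x < e)) ->
    exists q, [/\ gauge q, gauge_le f q,
      (exists2 e', 0 < e' & forall x, ~ (q x < e' /\ g x < e')) &
      (exists2 e', 0 < e' & forall x, ~ (q x < e' /\ k x < e'))]].
Proof.
move=> [fc f0 finf].
pose h x := (f x)^-1.
have hc : continuous h by move=> x; apply: continuousV; [rewrite gt_eqF|exact: fc].
have h0 x : 0 < h x by rewrite invr_gt0.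
have [u u1] : exists u : nat -> X, forall i j, (i < j)%N -> h (u i) + 1 <= h (u j).
  apply: (@greedy_sequence X (fun x y => h x + 1 <= h y)) => s.
  have [M M0 sM] : exists2 M, 0 < M & forall x, x \in s -> h x <= M.
    elim: s => [|x s [M M0 sM]]; first by exists 1.
    exists (Num.max M (h x)); first by rewrite lt_max M0.
    move=> y; rewrite inE => /orP[/eqP->|/sM yM]; rewrite le_max.
      by rewrite lexx orbT.
    by rewrite yM.
  have M1 : 0 < M + 1 by rewrite addr_gt0.
  have [y fy] := finf (M + 1)^-1 (ltac:(by rewrite invr_gt0)).
  exists y => x /sM xM; apply: (@le_trans _ _ (M + 1)); first by rewrite lerD2r.
  by rewrite /h -[M + 1]invrK lef_pV2 ?posrE ?invr_gt0// ltW.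
have [c [c01 csmall crec]] := recurrent_weights.
have hu k : k%:R < h (u k).
  elim: k => [|k IH]; first exact: h0.
  by have := u1 _ _ (ltnSn k); rewrite -natr1; lra.
pose S x := range (fun k => c k + `|h x - h (u k)|).
have S0 x : S x !=set0 by exists (c 0%N + `|h x - h (u 0%N)|), 0%N.
have lS x : lbound (S x) 0.
  by move=> _ [k _ <-]; rewrite addr_ge0// ltW//; case/andP: (c01 k).
pose psi x := inf (S x).
have psic : continuous psi.
  apply: dominated_continuous hc _.
  have psis x y : psi x <= psi y + `|h x - h y|.
    apply: inf_shift => // _ [k _ <-]; exists (c k + `|h x - h (u k)|).
      by exists k.
    have := ler_distD (h y) (h x) (h (u k)); lra.
  move=> x y; have := psis x y; have := psis y x.
  by rewrite (distrC (h y)) ler_norml; lra.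
have psiu k : psi (u k) = c k.
  apply/le_anti/andP; split.
    apply: ge_inf; first by exists 0; exact: lS.
    by exists k => //; rewrite subrr normr0 addr0.
  apply: lb_le_inf => // _ [j _ <-].
  have [->|jk] := eqVneq j k; first by rewrite subrr normr0 addr0.
  have cj := c01 j; have ck := c01 k; move: jk; rewrite neq_ltn => /orP[]/u1 jk.
    have : h (u k) - h (u j) <= `|h (u k) - h (u j)| := ler_norm _.
    lra.
  have : h (u j) - h (u k) <= `|h (u k) - h (u j)| by rewrite distrC ler_norm.
  lra.
have column k e : 0 < e -> exists2 x, f x < e & psi x = c k.
  move=> e0; have [n en cn] := crec k (Num.truncn e^-1).+1.
  exists (u n); last by rewrite psiu.
  rewrite -[f _]invrK -/(h _) invf_plt ?posrE//.
  apply: le_lt_trans (hu n); apply: (@le_trans _ _ (Num.truncn e^-1).+1%:R).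
    by rewrite ltW// truncnS_gt.
  by rewrite ler_nat.
exists (f \max psi); split.
- apply: gauge_max => // e e0; have [k ck] := csmall _ e0.
  by have [x fx psix] := column k _ e0; exists x => //; rewrite psix.
- exact: gauge_le_maxl.
- have /andP[c0 _] := c01 0%N.
  move=> /(_ _ c0)[e e0 eP]; have [x fx psix] := column 0%N _ e0.
  by have := eP _ fx; rewrite gt_max psix ltxx andbF.
- move=> k e e0 gk; have [n cn] := csmall (e / 2) (ltac:(by rewrite divr_gt0)).
  have /andP[cn0 _] := c01 n.
  have qc : continuous (fun x => `|psi x - c n|).
    move=> x; apply: (@cvg_norm _ _ _ (nbhs x)).
    by apply: cvgB; [exact: psic|exact: cvg_cst].
  have cn2 : 0 < c n / 2 by rewrite divr_gt0.
  exists (f \max (fun x => `|psi x - c n|)); split.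
  + apply: gauge_max => // e' e'0; have [x fx psix] := column n _ e'0.
    by exists x => //; rewrite psix subrr normr0.
  + exact: gauge_le_maxl.
  + exists (c n / 2) => // x []; rewrite !gt_max ltr_norml => /and3P[_ + _].
    by move=> + /andP[_]; lra.
  + exists (c n / 2) => // x []; rewrite gt_max ltr_norml => /and3P[H1 H2 H3] H4.
    by apply: (gk x); rewrite gt_max; split; [apply/andP|]; lra.
Qed.

End uncomplemented.

(** * The order-theoretic invariant *)

Definition order_compatible (S : Type) (le : S -> S -> Prop) (a b : S) :=
  exists2 z, le a z & le b z.

(** Here [c] is a complement of [b] in the part of the order above [a], where
    two elements without common upper bound count as disjoint. *)
Definition relatively_complemented (S : Type) (le : S -> S -> Prop) :=
  forall a b, le a b -> ~ le b a ->
    exists c, [/\ le a c, ~ order_compatible le b c &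
      forall d, le a d -> order_compatible le d b \/ order_compatible le d c].

Lemma relatively_complemented_iso (S T : Type) (leS : S -> S -> Prop)
    (leT : T -> T -> Prop) : order_isomorphic leS leT ->
  relatively_complemented leS -> relatively_complemented leT.
Proof.
move=> [f [g fK gK] fle] cS.
have gle x y : leT x y <-> leS (g x) (g y) by rewrite fle !gK.
have compE x y :
    order_compatible leT x y <-> order_compatible leS (g x) (g y).
  split=> [[z xz yz]|[z xz yz]]; first by exists (g z); apply/gle.
  by exists (f z); apply/gle; rewrite fK.
move=> a b /gle ab ba.
have [|c [ac bc cP]] := cS _ _ ab; first by move/gle.
exists (f c); split; first by apply/gle; rewrite fK.
  by move/compE; rewrite fK.
by move=> d /gle/cP[] H; [left|right]; apply/compE; rewrite ?fK.
Qed.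

Section classes.
Context {R : realType} {X : topologicalType}.
Implicit Types (Y : one_point_ext R X) (f g : X -> R) (C : ext_E R X).

(** The order on classes only depends on representing gauges, by
    [represents_le]. *)
Definition represents C f := exists2 Y, sval C Y & gauge_of Y f.

Lemma ext_equiv_refl Y : ext_equiv Y Y.
Proof. by exists id => //; exists id; split=> // x; exact: cvg_id. Qed.

Lemma ext_le_trans Y1 Y2 Y3 : ext_le Y1 Y2 -> ext_le Y2 Y3 -> ext_le Y1 Y3.
Proof.
move=> [f fc fX] [g gc gX]; exists (f \o g); last by move=> x; rewrite /= gX.
by move=> x; exact: continuous_comp (gc _) (fc _).
Qed.

Lemma ext_equiv_le Y1 Y2 : ext_equiv Y1 Y2 -> ext_le Y1 Y2 /\ ext_le Y2 Y1.
Proof.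
move=> [f [g [fK gK fc gc]] fX]; split; last by exists f.
by exists g => // x; rewrite -fX fK.
Qed.

Lemma class_ext_le C Y1 Y2 : sval C Y1 -> sval C Y2 -> ext_le Y1 Y2.
Proof.
case: C => /= _ [Y ->] /ext_equiv_le[_ Y1Y] /ext_equiv_le[YY2 _].
exact: ext_le_trans Y1Y YY2.
Qed.

Lemma represents_le C1 C2 f1 f2 : represents C1 f1 -> represents C2 f2 ->
  ext_E_le C1 C2 <-> gauge_le f1 f2.
Proof.
move=> [Y1 CY1 Yf1] [Y2 CY2 Yf2]; rewrite -(ext_leP Yf1 Yf2); split.
  move=> [Z1 [Z2 [CZ1 CZ2 Z12]]].
  exact: ext_le_trans (class_ext_le CY1 CZ1)
    (ext_le_trans Z12 (class_ext_le CZ2 CY2)).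
by exists Y1, Y2.
Qed.

Lemma represents_exists C : exists2 f, gauge f & represents C f.
Proof.
case: (svalP C) => Y CE; have [f Yf] := gauge_of_exists Y.
exists f; first by case: Yf.
by exists Y => //; rewrite CE; exact: ext_equiv_refl.
Qed.

Lemma gauge_represents f : metrizable R X -> gauge f -> exists C, represents C f.
Proof.
move=> mX /(gauge_ext mX)[Y Yf].
exists (exist _ (ext_equiv Y) (ex_intro _ Y erefl)), Y => //.
exact: ext_equiv_refl.
Qed.

(** A gauge above both [f] and [g] would have points where both are small. *)
Lemma represents_separated C D f g : represents C f -> represents D g ->
  (exists2 e, 0 < e & forall x, ~ (f x < e /\ g x < e)) ->
  ~ order_compatible (@ext_E_le R X) C D.
Proof.
move=> Cf Dg [e e0 eP] [Z CZ DZ].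
have [h [_ _ hinf] Zh] := represents_exists Z.
have [a a0 aP] := (represents_le Cf Zh).1 CZ _ e0.
have [b b0 bP] := (represents_le Dg Zh).1 DZ _ e0.
have [x] := hinf (Num.min a b) (ltac:(by rewrite lt_min a0)).
by rewrite lt_min => /andP[/aP fx /bP gx]; apply: (eP x).
Qed.

Lemma EK_represents_exists (C : ext_EK R X) : locally_compact [set: X] ->
  exists f, [/\ gauge f, gauge_lc f & represents (sval C) f].
Proof.
move=> Xlc; case: (svalP C) => Y CY Ylc.
have [f Yf] := gauge_of_exists Y; exists f; split.
- by case: Yf.
- exact/(gauge_lcP Yf Xlc).
- by exists Y.
Qed.

Lemma gauge_lc_represents f : metrizable R X -> locally_compact [set: X] ->
  gauge f -> gauge_lc f -> exists C : ext_EK R X, represents (sval C) f.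
Proof.
move=> mX Xlc fg /= flc; have [C [Y CY Yf]] := gauge_represents mX fg.
have CK : exists2 Y, sval C Y & locally_compact [set: Y].
  by exists Y => //; exact/(gauge_lcP Yf Xlc).
by exists (exist _ C CK), Y.
Qed.

Lemma EK_relatively_complemented : metrizable R X -> locally_compact [set: X] ->
  relatively_complemented (@ext_EK_le R X).
Proof.
move=> mX Xlc A B AB BA.
have [f [fg flc Af]] := EK_represents_exists A Xlc.
have [g [gg glc Bg]] := EK_represents_exists B Xlc.
have [|k [kg klc fk [e e0 gk] kP]] :=
    gauge_lc_complement fg gg flc glc ((represents_le Af Bg).1 AB).
  by move=> gf; apply: BA; apply/(represents_le Bg Af).
have [K Kk] := gauge_lc_represents mX Xlc kg klc.
exists K; split; first exact/(represents_le Af Kk).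
  have := represents_separated Bg Kk (ex_intro2 _ _ e e0 gk).
  by move=> + [Z BZ KZ]; apply; exists (sval Z).
move=> H AH; have [h [hg hlc Hh]] := EK_represents_exists H Xlc.
have [gh|hk] := kP _ hg ((represents_le Af Hh).1 AH); [left|right].
  exists H; last exact/(represents_le Bg Hh).
  by apply/(represents_le Hh Hh) => a a0; exists a.
have [hc _ _] := hg; have [kc _ _] := kg.
have [M Mhk] := gauge_lc_represents mX Xlc (gauge_max hg kc hk)
  (gauge_lc_max hc kc hlc klc).
exists M; first exact/(represents_le Hh Mhk)/gauge_le_maxl.
exact/(represents_le Kk Mhk)/gauge_le_maxr.
Qed.

Lemma E_not_relatively_complemented : metrizable R X -> ~ compact [set: X] ->
  ~ relatively_complemented (@ext_E_le R X).
Proof.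
move=> mX Xnc Ec; have [d hd] := metrizable_dist mX.
have [f fg] := noncompact_gauge hd Xnc.
have [g [gg fg_le gf_nle gP]] := gauge_uncomplemented fg.
have [A Af] := gauge_represents mX fg.
have [B Bg] := gauge_represents mX gg.
have [|K [AK BK KP]] := Ec A B ((represents_le Af Bg).2 fg_le).
  by move/(represents_le Bg Af).
have [k kg Kk] := represents_exists K.
have [e e0 gk] : exists2 e, 0 < e & forall x, ~ (g x < e /\ k x < e).
  apply: contrapT => H; apply: BK.
  have kc : continuous k by case: kg.
  have [|M Mgk] := gauge_represents mX (gauge_max gg kc _).
    move=> e e0; apply: contrapT => H'; apply: H; exists e => // x [gx kx].
    by apply: H'; exists x.
  exists M; first exact/(represents_le Bg Mgk)/gauge_le_maxl.
  exact/(represents_le Kk Mgk)/gauge_le_maxr.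
have [h [hg fh hg_sep hk_sep]] := gP k e e0 gk.
have [H Hh] := gauge_represents mX hg.
have [] := KP H ((represents_le Af Hh).2 fh).
  exact: represents_separated Hh Bg hg_sep.
exact: represents_separated Hh Kk hk_sep.
Qed.

End classes.

Theorem theorem3p7 (R : realType) (X : topologicalType)
    (hmetr : metrizable R X)
    (hlc : locally_compact [set: X])
    (hnc : ~ compact [set: X]) :
  ~ order_isomorphic (@ext_EK_le R X) (@ext_E_le R X).
Proof.
move=> /relatively_complemented_iso/(_ (EK_relatively_complemented hmetr hlc)).
exact: E_not_relatively_complemented.
Qed.
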